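(* Let $\mathcal{A} \subseteq \mathcal{B}$ be a finite-index inclusion. Then $\mathcal{A} \subseteq \mathcal{B}$ has a unique conditional expectation if and only if $\mathcal{A}' \cap \mathcal{B} = Z(\mathcal{A})$.
   Context: A $C^*$-inclusion $\mathcal{A} \subseteq \mathcal{B}$ is an inclusion of unital $C^*$-algebras with $1_{\mathcal{B}} = 1_{\mathcal{A}}$. $Z(\mathcal{A})$ is the center of $\mathcal{A}$ and $\mathcal{A}' \cap \mathcal{B}$ is the relative commutant. A conditional expectation for $\mathcal{A} \subseteq \mathcal{B}$ is a unital completely positive map $E: \mathcal{B} \to \mathcal{A}$ with $E(a) = a$ for all $a \in \mathcal{A}$; ''unique conditional expectation'' means there is exactly one such map. A conditional expectation $E: \mathcal{B} \to \mathcal{A}$ has finite index (in the sense of Watatani) if there exists a finite set $\{(u_1,v_1), \dots, (u_n,v_n)\} \subseteq \mathcal{B} \times \mathcal{B}$ such that for all $b \in \mathcal{B}$, $b = \sum_j u_j E(v_j b) = \sum_j E(b u_j) v_j$. The inclusion $\mathcal{A} \subseteq \mathcal{B}$ has finite index if it admits a finite-index conditional expectation. *)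

(* Defs.v *)
From HB Require Import structures.
From mathcomp Require Import all_boot all_order all_algebra.
From mathcomp Require Import complex.
From mathcomp Require Import all_classical all_reals all_analysis.

Set Implicit Arguments.
Unset Strict Implicit.
Unset Printing Implicit Defensive.

Import Order.TTheory GRing.Theory Num.Theory.
Import numFieldNormedType.Exports.
Import ComplexField.Normc.

Local Open Scope classical_set_scope.
Local Open Scope ring_scope.

Definition norm_cauchy (R : realType) (B : zmodType) (norm : B -> R)
    (u : nat -> B) : Prop :=
  forall e : R, 0 < e ->
    exists N, forall m n, (N <= m)%N -> (N <= n)%N -> norm (u m - u n) < e.

Definition norm_cvg (R : realType) (B : zmodType) (norm : B -> R)
    (u : nat -> B) (l : B) : Prop :=
  norm (u n - l) @[n --> \oo] --> (0 : R).

(* The norm is a field of the mixin because Hierarchy Builder rejects a join of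
   nzRingType and normedModType: their only join in MathComp is numDomainType.
   As for every algType, 1 != 0. *)
HB.mixin Record isCStarAlgebra (R : realType) (B : Type)
    of GRing.Algebra R[i] B := {
  star : B -> B ;
  starK : involutive star ;
  starD : forall x y : B, star (x + y) = star x + star y ;
  starZ : forall (a : R[i]) (x : B), star (a *: x) = a^* *: star x ;
  starM : forall x y : B, star (x * y) = star y * star x ;
  cnorm : B -> R ;
  cnorm_eq0 : forall x : B, cnorm x = 0 -> x = 0 ;
  cnormD : forall x y : B, cnorm (x + y) <= cnorm x + cnorm y ;
  cnormZ : forall (a : R[i]) (x : B), cnorm (a *: x) = normc a * cnorm x ;
  cnormM : forall x y : B, cnorm (x * y) <= cnorm x * cnorm y ;
  cnorm_starM : forall x : B, cnorm (star x * x) = cnorm x ^+ 2 ;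
  cnorm_complete : forall u : nat -> B,
    norm_cauchy cnorm u -> exists l, norm_cvg cnorm u l
}.

#[short(type="cstarAlgebraType")]
HB.structure Definition CStarAlgebra (R : realType) :=
  { B of GRing.Algebra R[i] B & isCStarAlgebra R B }.

(* A C*-inclusion is a C*-algebra B with a subset A satisfying this predicate. *)
Record cstar_subalgebra (R : realType) (B : cstarAlgebraType R) (A : set B) :
    Prop := CStarSubalgebra {
  csub1 : A 1 ;
  csubD : forall x y : B, A x -> A y -> A (x + y) ;
  csubZ : forall (a : R[i]) (x : B), A x -> A (a *: x) ;
  csubM : forall x y : B, A x -> A y -> A (x * y) ;
  csub_star : forall x : B, A x -> A (star x) ;
  csub_closed : forall (u : nat -> B) (l : B),
    (forall n, A (u n)) -> norm_cvg (@cnorm R B) u l -> A l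
}.

Definition relative_commutant (R : realType) (B : cstarAlgebraType R)
    (A : set B) : set B :=
  [set b | forall a, A a -> a * b = b * a].

Definition alg_center (R : realType) (B : cstarAlgebraType R)
    (A : set B) : set B :=
  [set z | A z /\ forall a, A a -> a * z = z * a].

Definition mx_star (R : realType) (B : cstarAlgebraType R) (m n : nat)
    (X : 'M[B]_(m, n)) : 'M[B]_(n, m) :=
  \matrix_(i, j) star (X j i).

(* The positive elements of a C*-algebra are the elements of the form y^* y;
   here the C*-algebra is M_n(A). *)
Definition mx_positive (R : realType) (B : cstarAlgebraType R) (A : set B)
    (n : nat) (X : 'M[B]_n) : Prop :=
  exists2 Y : 'M[B]_n, (forall i j, A (Y i j)) & X = mx_star Y *m Y.

(* Maps from B to A are represented by maps from B to B with values in A. *)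
Definition completely_positive (R : realType) (B : cstarAlgebraType R)
    (A : set B) (E : B -> B) : Prop :=
  forall (n : nat) (X : 'M[B]_n),
    mx_positive [set: B] X -> mx_positive A (map_mx E X).

Record conditional_expectation (R : realType) (B : cstarAlgebraType R)
    (A : set B) (E : B -> B) : Prop := ConditionalExpectation {
  cexp_range : forall b : B, A (E b) ;
  cexp_linear : linear E ;
  cexp1 : E 1 = 1 ;
  cexp_cp : completely_positive A E ;
  cexp_id : forall a : B, A a -> E a = a
}.

Definition finite_index (R : realType) (B : cstarAlgebraType R)
    (E : B -> B) : Prop :=
  exists (n : nat) (u v : 'I_n -> B), forall b : B,
    b = \sum_(j < n) u j * E (v j * b) /\
    b = \sum_(j < n) E (b * u j) * v j.

Definition finite_index_inclusion (R : realType) (B : cstarAlgebraType R)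
    (A : set B) : Prop :=
  exists2 E : B -> B, conditional_expectation A E & finite_index E.

(* Main.v *)
(* Positivity in a C*-algebra needs no spectral theory: an element is
   positive when it is the square of a self-adjoint element, square roots of
   [1 - k] with [|k| <= 1] come from the iteration [z = (k + z^2) / 2], and
   [x^* x] is such a square, so [sum_i x_i^* x_i = 0] forces all [x_i = 0].
   Complete positivity on Gram matrices then gives that a conditional
   expectation is [A]-bimodular, and that it is faithful if it has finite index.

   If the relative commutant is the center and [E] has quasi-basis [(u_j, v_j)],
   any conditional expectation is [F b = E (h b)] with [h] in the relative
   commutant; then [h] is in [A] and [h = F 1 = 1]. Conversely, for self-adjoint
   [x] in the relative commutant let [g] be a square root of [1 - k], where [k]
   is a small multiple of [x - E x]. Then [b |-> E (g b g)] is a conditional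
   expectation, so it is [E]; this gives [E (k^2) = E k - E (g k g) = 0],
   hence [k = 0] and [x] is in [A]. *)
Require Import Defs.
From mathcomp Require Import all_boot all_order all_algebra.
From mathcomp Require Import complex.
From mathcomp Require Import all_classical all_reals all_analysis.
From mathcomp Require Import lra.

Set Implicit Arguments.
Unset Strict Implicit.
Unset Printing Implicit Defensive.

Import Order.TTheory GRing.Theory Num.Theory.
Import numFieldNormedType.Exports.
Import ComplexField.Normc.

Local Open Scope ring_scope.
Local Open Scope complex_scope.

Section CStarAlgebraTheory.
Variables (R : realType) (B : cstarAlgebraType R).
Implicit Types (x y s v k : B) (t e : R).

(** * Elementary identities for the involution and the norm *)

Lemma star0 : star (0 : B) = 0.
Proof. by apply: (addrI (star 0)); rewrite -starD !addr0. Qed.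

Lemma starN x : star (- x) = - star x.
Proof. by apply: (addrI (star x)); rewrite -starD !subrr star0. Qed.

Lemma starB x y : star (x - y) = star x - star y.
Proof. by rewrite starD starN. Qed.

Lemma star1 : star (1 : B) = 1.
Proof. by have := starM (star 1) (1 : B); rewrite mulr1 starK mulr1. Qed.

Lemma starZr t x : star (t%:C *: x) = t%:C *: star x.
Proof. by rewrite starZ; congr (_ *: _); exact: conjc_real. Qed.

Lemma starZi x : star ('i *: x) = - ('i *: star x).
Proof.
rewrite starZ -scaleNr; congr (_ *: _).
by apply/eqP; rewrite eq_complex /= oppr0 !eqxx.
Qed.

Lemma scale_ii x : 'i *: ('i *: x) = - x.
Proof.
rewrite scalerA (_ : 'i * 'i = -1 :> R[i]) ?scaleN1r// -expr2.
exact: sqr_i.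
Qed.

Lemma star_sum (I : Type) (r : seq I) (P : pred I) (F : I -> B) :
  star (\sum_(i <- r | P i) F i) = \sum_(i <- r | P i) star (F i).
Proof. exact: (big_morph _ starD star0). Qed.

Lemma cnormZr t x : cnorm (t%:C *: x) = `|t| * cnorm x.
Proof. by rewrite cnormZ /normc /= expr0n addr0 sqrtr_sqr. Qed.

Lemma cnormN x : cnorm (- x) = cnorm x.
Proof.
have -> : - x = (-1 : R)%:C *: x by rewrite rmorphN rmorph1 scaleN1r.
by rewrite cnormZr normrN1 mul1r.
Qed.

Lemma cnorm0 : cnorm (0 : B) = 0.
Proof.
rewrite -(scale0r (0 : B)) -(rmorph0 (real_complex R)).
by rewrite cnormZr normr0 mul0r.
Qed.

Lemma cnorm_ge0 x : 0 <= cnorm x.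
Proof. by have := cnormD x (- x); rewrite subrr cnorm0 cnormN; lra. Qed.

Lemma cnormB x y : cnorm (x - y) <= cnorm x + cnorm y.
Proof. by rewrite -(cnormN y); exact: cnormD. Qed.

Lemma cnormBC x y : cnorm (x - y) = cnorm (y - x).
Proof. by rewrite -cnormN opprB. Qed.

Lemma cnorm_star x : cnorm (star x) = cnorm x.
Proof.
have le y : cnorm y <= cnorm (star y).
  have := cnormM (star y) y; rewrite cnorm_starM expr2.
  have [->|y0] := eqVneq (cnorm y) 0; first by rewrite cnorm_ge0.
  by rewrite ler_pM2r// lt0r y0 cnorm_ge0.
by apply/le_anti; rewrite le andbT -{2}(starK x) le.
Qed.

Lemma cnorm_sq s : star s = s -> cnorm (s * s) = cnorm s ^+ 2.
Proof. by move=> sE; rewrite -{1}sE cnorm_starM. Qed.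

Lemma cnorm1 : cnorm (1 : B) = 1.
Proof.
have := cnorm_sq star1; rewrite mulr1 expr2 => n1.
have /mulfI : cnorm (1 : B) != 0.
  by apply/eqP => /cnorm_eq0/eqP; rewrite oner_eq0.
by apply; rewrite mulr1 -n1.
Qed.

Lemma star_mul_eq0 x : star x * x = 0 -> x = 0.
Proof.
move=> x0; apply: cnorm_eq0; apply/eqP; rewrite -sqrf_eq0 -cnorm_starM x0.
by rewrite cnorm0.
Qed.

(** This is how identities pass to norm limits: approximate to within [e] and bound the defect by a
    fixed multiple of [e]. *)
Lemma cnorm_eq0_small x (C : R) :
  (forall e, 0 < e -> cnorm x <= C * e) -> x = 0.
Proof.
move=> small; apply: cnorm_eq0; apply/le_anti; rewrite cnorm_ge0 andbT.
apply/ler_addgt0Pr => e e0; rewrite add0r.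
have C1 : 0 < `|C| + 1 by rewrite ltr_wpDl.
apply: le_trans (small (e / (`|C| + 1)) _) _; first by rewrite divr_gt0.
rewrite mulrA ler_pdivrMr// mulrC ler_wpM2l ?ltW//.
by have := ler_norm C; lra.
Qed.

Lemma scale_half_add x : 2^-1%:C *: x + 2^-1%:C *: x = x.
Proof.
by rewrite -scalerDl -rmorphD (_ : 2^-1 + 2^-1 = 1) ?scale1r//; lra.
Qed.

(** * Properties preserved by norm limits *)

Lemma norm_cvgP (u : nat -> B) (l : B) : norm_cvg cnorm u l ->
  forall e, 0 < e -> exists N, forall n, (N <= n)%N -> cnorm (u n - l) < e.
Proof.
move=> /cvgr0Pnorm_lt ul e e0; have [N _ HN] := ul e e0.
by exists N => n /HN; rewrite /= ger0_norm ?cnorm_ge0.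
Qed.

Lemma commZl (a : R[i]) x y : GRing.comm x y -> GRing.comm (a *: x) y.
Proof. by move=> xy; rewrite /GRing.comm -scalerAl -scalerAr xy. Qed.

Lemma comm_cvg (u : nat -> B) (l : B) y : norm_cvg cnorm u l ->
  (forall n, GRing.comm (u n) y) -> GRing.comm l y.
Proof.
move=> /norm_cvgP ul uy; apply/eqP; rewrite -subr_eq0; apply/eqP.
apply: (@cnorm_eq0_small _ (2 * cnorm y)) => e /ul[N /(_ N (leqnn N)) uN].
have -> : l * y - y * l = y * (u N - l) - (u N - l) * y.
  by rewrite mulrBr mulrBl (uy N) opprB [RHS]addrC subrKA.
apply: le_trans (cnormB _ _) _.
apply: le_trans (lerD (cnormM _ _) (cnormM _ _)) _.
by have := cnorm_ge0 y; nra.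
Qed.

Lemma self_adjoint_cvg (u : nat -> B) (l : B) : norm_cvg cnorm u l ->
  (forall n, star (u n) = u n) -> star l = l.
Proof.
move=> /norm_cvgP ul us; apply/eqP; rewrite -subr_eq0; apply/eqP.
apply: (@cnorm_eq0_small _ 2) => e /ul[N /(_ N (leqnn N)) uN].
have -> : star l - l = (u N - l) - star (u N - l).
  by rewrite starB us opprB [RHS]addrC subrKA.
by have := cnormB (u N - l) (star (u N - l)); rewrite cnorm_star; lra.
Qed.

Lemma cnorm_cvg_le (u : nat -> B) (l : B) t : norm_cvg cnorm u l ->
  (forall n, cnorm (u n) <= t) -> cnorm l <= t.
Proof.
move=> /norm_cvgP ul ut; apply/ler_addgt0Pr => e /ul[N /(_ N (leqnn N)) uN].
have := cnormB (u N) (u N - l); rewrite subKr => h.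
by have := ut N; lra.
Qed.

(** * Square roots of [1 - k] by iteration *)

(* The sequence tending to [1 - sqrt (1 - k)]. *)
Fixpoint sqrt_iter k n : B :=
  if n is n'.+1 then 2^-1%:C *: (k + sqrt_iter k n' * sqrt_iter k n') else 0.

(* The same sequence for the real number [k = 1]; it dominates the former. *)
Fixpoint dom_iter n : R :=
  if n is n'.+1 then 2^-1 * (1 + dom_iter n' ^+ 2) else 0.

Lemma dom_iter_bound n : 0 <= dom_iter n <= 1.
Proof. by elim: n => [|n /andP[h0 h1]] /=; [lra|apply/andP; split; nra]. Qed.

Lemma dom_iter_cauchy e : 0 < e -> exists N, forall m n,
  (N <= m)%N -> (N <= n)%N -> `|dom_iter m - dom_iter n| < e.
Proof.
move=> e0; have nd : nondecreasing_seq dom_iter.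
  (* Each increment of [dom_iter] is half of this square. *)
  apply/nondecreasing_seqP => n /=; have := sqr_ge0 (1 - dom_iter n); nra.
have : cvgn dom_iter.
  apply: nondecreasing_is_cvgn => //; exists 1 => _ [n _ <-].
  by case/andP: (dom_iter_bound n).
move=> /cvg_ex[l] /cvgrPdist_lt /(_ (e / 2)) /(_ ltac:(lra)) [N _ HN].
exists N => m n /HN /= mN /HN /= nN.
have -> : dom_iter m - dom_iter n = (l - dom_iter n) - (l - dom_iter m) by lra.
by have := ler_normB (l - dom_iter n) (l - dom_iter m); lra.
Qed.

Lemma sqrt_iter_comm k n y : GRing.comm k y -> GRing.comm (sqrt_iter k n) y.
Proof.
move=> ky; elim: n => [|n IH] /=; first exact/commr_sym/commr0.
apply: commZl; apply: commr_sym; apply: commrD; first exact: commr_sym.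
by apply: commrM; exact: commr_sym.
Qed.

Lemma sqrt_iter_comm2 k m n : GRing.comm (sqrt_iter k m) (sqrt_iter k n).
Proof.
by apply: sqrt_iter_comm; apply: commr_sym; exact: sqrt_iter_comm.
Qed.

Lemma sqrt_iter_star k n : star k = k -> star (sqrt_iter k n) = sqrt_iter k n.
Proof.
by move=> ks; elim: n => [|n IH] /=; rewrite ?star0// starZr starD starM ks IH.
Qed.

Lemma sqrt_iter_le k n : cnorm k <= 1 -> cnorm (sqrt_iter k n) <= dom_iter n.
Proof.
move=> k1; elim: n => [|n IH] /=; first by rewrite cnorm0.
rewrite cnormZr ger0_norm ?invr_ge0//.
have := cnormD k (sqrt_iter k n * sqrt_iter k n).
have := cnormM (sqrt_iter k n) (sqrt_iter k n).
by have := cnorm_ge0 (sqrt_iter k n); nra.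
Qed.

(** The iterates commute, so a difference of their squares factors as difference times sum. The
    increments of [dom_iter] factor in the same way, and the bounds compare factor by factor. *)
Lemma sqrt_iter_step k n : cnorm k <= 1 ->
  cnorm (sqrt_iter k n.+1 - sqrt_iter k n) <= dom_iter n.+1 - dom_iter n.
Proof.
move=> k1; elim: n => [|n IH].
  by have := sqrt_iter_le 1 k1; rewrite /= !subr0.
set a := sqrt_iter k n.+1 in IH *; set b := sqrt_iter k n in IH.
have -> : sqrt_iter k n.+2 - a = 2^-1%:C *: ((a - b) * (a + b)).
  rewrite {2}/a /= -/a -/b -scalerBr; congr (_ *: _).
  rewrite opprD addrACA subrr add0r mulrDr !mulrBl (sqrt_iter_comm2 k n n.+1).
  by rewrite -/a -/b addrA subrK.
rewrite cnormZr ger0_norm ?invr_ge0//.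
have := cnormM (a - b) (a + b); have := cnormD a b.
have := sqrt_iter_le n.+1 k1; have := sqrt_iter_le n k1; rewrite -/a -/b.
have := cnorm_ge0 (a - b); have := cnorm_ge0 (a + b).
have -> : dom_iter n.+2 - dom_iter n.+1
    = 2^-1 * ((dom_iter n.+1 - dom_iter n) * (dom_iter n.+1 + dom_iter n)).
  rewrite /=; lra.
move=> h1 h2 h3 h4 h5 h6; apply: ler_wpM2l; first by rewrite invr_ge0.
by apply: le_trans h6 _; apply: ler_pM => //; lra.
Qed.

Lemma sqrt_iter_dist k m n : cnorm k <= 1 ->
  cnorm (sqrt_iter k m - sqrt_iter k n) <= `|dom_iter m - dom_iter n|.
Proof.
move=> k1; wlog le : m n / (m <= n)%N.
  by move=> th; case: (leqP m n) => [/th //|/ltnW /th]; rewrite cnormBC distrC.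
rewrite -(subnK le) cnormBC distrC; apply: le_trans (ler_norm _).
elim: (n - m)%N => [|p IH]; first by rewrite !subrr cnorm0.
rewrite addSn -(subrKA (sqrt_iter k (p + m))).
apply: le_trans (cnormD _ _) _.
by have := sqrt_iter_step (p + m) k1; lra.
Qed.

(** The limit [l] of the iteration satisfies [l = (k + l^2) / 2], that is, [(1 - l)^2 = 1 - k]. *)
Lemma sqrt_one_sub k : star k = k -> cnorm k <= 1 ->
  exists s, [/\ star s = s, 1 - k = s * s, cnorm (1 - s) <= 1 &
    forall y, GRing.comm k y -> GRing.comm s y].
Proof.
move=> ks k1.
have [l ul] : exists l, norm_cvg cnorm (sqrt_iter k) l.
  apply: cnorm_complete => e /dom_iter_cauchy[N HN]; exists N => m n mN nN.
  exact: le_lt_trans (sqrt_iter_dist _ _ k1) (HN m n mN nN).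
have l1 : cnorm l <= 1.
  apply: cnorm_cvg_le ul _ => n; apply: le_trans (sqrt_iter_le n k1) _.
  by case/andP: (dom_iter_bound n).
have lE : l = 2^-1%:C *: (k + l * l).
  apply/eqP; rewrite -subr_eq0; apply/eqP; apply: (@cnorm_eq0_small _ 2) => e.
  move=> /(norm_cvgP ul)[N HN]; set z := sqrt_iter k N.
  have := HN _ (leqnSn N); have := HN _ (leqnn N); rewrite /= -/z => h1 h2.
  (* The defect of [l] is compared with the next iterate after [z], using
     [z^2 - l^2 = z (z - l) + (z - l) l]. *)
  have -> : l - 2^-1%:C *: (k + l * l) =
      - (2^-1%:C *: (k + z * z) - l)
      + 2^-1%:C *: (z * (z - l) + (z - l) * l).
    rewrite opprB -addrA; congr (_ + _).
    rewrite -!scalerN -scalerDr; congr (_ *: _).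
    by rewrite mulrBr mulrBl subrKA !opprD -addrA addKr.
  apply: le_trans (cnormD _ _) _; rewrite cnormN cnormZr ger0_norm ?invr_ge0//.
  have := cnormD (z * (z - l)) ((z - l) * l).
  have := cnormM z (z - l); have := cnormM (z - l) l.
  have := cnorm_ge0 (z - l); have := cnorm_ge0 z; have := cnorm_ge0 l.
  have : cnorm z <= 1.
    apply: le_trans (sqrt_iter_le N k1) _; by case/andP: (dom_iter_bound N).
  by nra.
exists (1 - l); split; last 2 first.
- by rewrite subKr.
- move=> y ky; apply: commr_sym; apply: commrB; first exact: commr1.
  by apply: commr_sym; apply: comm_cvg ul _ => n; exact: sqrt_iter_comm.
- rewrite starB star1; congr (_ - _).
  by apply: self_adjoint_cvg ul _ => n; exact: sqrt_iter_star.
- have kE : k = l + l - l * l by rewrite {1 2}lE scale_half_add addrK.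
  rewrite mulrBr mulr1 mulrBl mul1r -addrA {1}kE opprB; congr (_ + _).
  by rewrite opprB opprD addrA [RHS]addrC.
Qed.

(** * Sums of squares of self-adjoint elements *)

Lemma rscaleM (a b : R) x y : (a%:C *: x) * (b%:C *: y) = (a * b)%:C *: (x * y).
Proof. by rewrite -scalerAl -scalerAr scalerA -rmorphM. Qed.

(* [s + i v] is normal, with adjoint [s - i v]. *)
Lemma cnorm_sq_le s v : star s = s -> star v = v -> GRing.comm s v ->
  cnorm s ^+ 2 <= cnorm (s * s + v * v).
Proof.
move=> ss vs sv; pose g := s + 'i *: v.
have gs : star g = s - 'i *: v by rewrite starD starZi ss vs.
have -> : s * s + v * v = star g * g.
  rewrite gs mulrDr !mulrBl -!scalerAl -!scalerAr sv scale_ii.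
  by rewrite opprK addrA subrK.
rewrite cnorm_starM; have := cnorm_ge0 s.
suff : cnorm s <= cnorm g by move=> h1 h2; rewrite ler_sqr// nnegrE cnorm_ge0.
have -> : s = 2^-1%:C *: (g + star g).
  by rewrite gs addrACA subrr addr0 scalerDr scale_half_add.
rewrite cnormZr ger0_norm ?invr_ge0//.
by have := cnormD g (star g); rewrite cnorm_star; lra.
Qed.

(** After rescaling to [t = 1], [1 - h^2] is a square [w^2] with [w] commuting with [h], and
    [w^2 + h^2 = 1] bounds [w]. *)
Lemma sub_sq_le t s : star s = s -> cnorm s ^+ 2 <= t ->
  cnorm (t%:C *: 1 - s * s) <= t.
Proof.
move=> ss st; have t0 : 0 <= t by apply: le_trans st; exact: sqr_ge0.
have [t00|tn0] := eqVneq t 0.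
  have -> : s = 0.
    apply: cnorm_eq0; apply/eqP.
    by rewrite -sqrf_eq0 eq_le sqr_ge0 -{1}t00 st.
  by rewrite mulr0 subr0 cnormZr cnorm1 mulr1 ger0_norm.
pose h := (Num.sqrt t)^-1%:C *: s.
have hs : star h = h by rewrite starZr ss.
have hh : h * h = t^-1%:C *: (s * s).
  by rewrite rscaleM -invfM -expr2 sqr_sqrtr.
have h1 : cnorm (h * h) <= 1.
  rewrite hh cnormZr cnorm_sq// ger0_norm ?invr_ge0//.
  by rewrite mulrC ler_pdivrMr ?mul1r// lt0r tn0.
have hhs : star (h * h) = h * h by rewrite starM hs.
have [w [ws wE _ wc]] := sqrt_one_sub hhs h1.
have -> : t%:C *: 1 - s * s = t%:C *: (w * w).
  by rewrite -wE hh scalerBr scalerA -rmorphM divff// scale1r.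
rewrite cnormZr ger0_norm// cnorm_sq// -[leRHS]mulr1 ler_wpM2l//.
have -> : 1 = cnorm (w * w + h * h) by rewrite -wE subrK cnorm1.
apply: cnorm_sq_le => //; apply: wc; apply: commr_sym.
by apply: commrM.
Qed.

(** The commutation clause stands in for [q] being a function of [x] in the functional calculus; [q]
    itself may fail to be positive. *)
Definition sqrt_of x q : Prop :=
  [/\ star q = q, x = q * q & forall y, GRing.comm x y -> GRing.comm q y].

(** For self-adjoint [x] the ball condition places the spectrum in [[0, 2t]]. The root satisfies the
    same condition with [Num.sqrt t], so roots can be taken repeatedly. *)
Lemma ball_sqrt t x : star x = x -> 0 <= t -> cnorm (t%:C *: 1 - x) <= t ->
  exists2 q, sqrt_of x q & cnorm ((Num.sqrt t)%:C *: 1 - q) <= Num.sqrt t.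
Proof.
move=> xs t0; have [->|tn0] := eqVneq t 0.
  rewrite scale0r sub0r cnormN => xle.
  have -> : x = 0 by apply: cnorm_eq0; apply/le_anti; rewrite xle cnorm_ge0.
  exists 0; last by rewrite sqrtr0 scale0r subr0 cnorm0.
  by split; rewrite ?star0 ?mulr0// => y _; apply: commr_sym; exact: commr0.
move=> xt; pose k := 1 - t^-1%:C *: x.
have kt : t%:C *: k = t%:C *: 1 - x.
  by rewrite scalerBr scalerA -rmorphM divff// scale1r.
have ks : star k = k by rewrite starB star1 starZr xs.
have k1 : cnorm k <= 1.
  by rewrite -(@ler_pM2l _ t) ?lt0r ?tn0// mulr1 -{1}(ger0_norm t0) -cnormZr kt.
have [w [ws wE w1 wc]] := sqrt_one_sub ks k1.
exists ((Num.sqrt t)%:C *: w).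
  split=> [||y xy]; first by rewrite starZr ws.
  - rewrite rscaleM -expr2 sqr_sqrtr// -wE opprB addrC subrK.
    by rewrite scalerA -rmorphM divff// scale1r.
  - apply: commZl; apply: wc; apply: commr_sym; apply: commrB.
      exact: commr1.
    by apply: commr_sym; exact: commZl.
rewrite -scalerBr cnormZr ger0_norm ?sqrtr_ge0//.
by rewrite -[leRHS]mulr1 ler_wpM2l// sqrtr_ge0.
Qed.

(** The ball condition of [ball_sqrt] is additive: centers and radii add up. *)
Lemma sqD_sqrt s v : star s = s -> star v = v ->
  exists q, sqrt_of (s * s + v * v) q.
Proof.
move=> ss vs; set t := cnorm s ^+ 2 + cnorm v ^+ 2.
have xs : star (s * s + v * v) = s * s + v * v by rewrite starD !starM ss vs.
have [||q qx _] := ball_sqrt xs (t := t); last by exists q.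
  by rewrite addr_ge0 ?sqr_ge0.
rewrite /t rmorphD scalerDl opprD addrACA.
by apply: le_trans (cnormD _ _) _; apply: lerD; exact: sub_sq_le.
Qed.

(** Since [s] and [v] may not commute, [s] is replaced by a root [q] of [s^2 = - v^2], which
    commutes with [v]. *)
Lemma sqD_eq0 s v : star s = s -> star v = v -> s * s + v * v = 0 -> s = 0.
Proof.
move=> ss vs sv0; have [q] := sqD_sqrt ss star0.
rewrite mulr0 addr0 => -[qs qE qc].
have vq : GRing.comm q v.
  apply: qc; have -> : s * s = - (v * v) by apply/eqP; rewrite -addr_eq0 sv0.
  by apply: commr_sym; apply: commrN; exact: commrM.
have := cnorm_sq_le qs vs vq; rewrite -qE sv0 cnorm0 => q0.
have : cnorm s ^+ 2 <= 0.
  rewrite -cnorm_sq// qE; apply: le_trans (cnormM _ _) _.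
  by rewrite -expr2.
move=> s0; apply: cnorm_eq0; apply/eqP; rewrite -sqrf_eq0.
by rewrite eq_le s0 sqr_ge0.
Qed.

(** * Positivity of [star x * x] *)

(** Here [p] is the absolute value of [x], and its root [q] witnesses that [p] is positive. *)
Lemma abs_sqrt x : star x = x ->
  exists p q, sqrt_of (x * x) p /\ sqrt_of p q.
Proof.
move=> xs; have xxs : star (x * x) = x * x by rewrite starM xs.
have [p px pt] := ball_sqrt xxs (sqr_ge0 (cnorm x)) (sub_sq_le xs (lexx _)).
have [ps _ _] := px.
have [q qp _] := ball_sqrt ps (sqrtr_ge0 _) pt.
by exists p, q.
Qed.

Lemma sqD x y : (x + y) * (x + y) = x * x + y * y + (x * y + y * x).
Proof. by rewrite mulrDl !mulrDr [y * x + _]addrC addrACA. Qed.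

Lemma sqB x y : (x - y) * (x - y) = x * x + y * y - (x * y + y * x).
Proof. by rewrite sqD mulrNN mulrN mulNr -opprD. Qed.

Lemma sqD_comm x y : GRing.comm x y ->
  (x + y) * (x + y) = (x * y) *+ 4 + (x - y) * (x - y).
Proof.
move=> xy; rewrite sqB sqD -xy -mulr2n [in RHS]addrCA; congr (_ + _).
by rewrite (mulrnDr _ 2 2) addrK.
Qed.

(* Evaluated on spectra, [y^* y <= 0 <= y y^*] forces [y = 0] because the two
   spectra agree away from 0. With [c = |y|^2] and [m = y y^*] this is replaced
   by [|c m + m^2| = |y (c + y^* y) y^*| <= c^2], which contradicts
   [(c m + m^2)^2 = 4 c m^3 + (c m - m^2)^2] unless [c = 0]. *)
Lemma neg_star_mul_pos y v r : star v = v -> star r = r ->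
  star y * y = - (v * v) -> y * star y = r * r -> y = 0.
Proof.
move=> vs rs yv yr; set c := cnorm r ^+ 2.
have cy : cnorm y ^+ 2 = c.
  rewrite /c -(cnorm_sq rs) -yr.
  by have := cnorm_starM (star y); rewrite starK cnorm_star.
have cv : cnorm v ^+ 2 = c by rewrite -cy -(cnorm_starM y) yv cnormN cnorm_sq.
set m := y * star y in yr.
pose M := c%:C *: m + m * m.
have ME : M = y * (c%:C *: 1 - v * v) * star y.
  rewrite -yv mulrDr mulrDl -scalerAr mulr1 -scalerAl -/m; congr (_ + _).
  by rewrite /m !mulrA.
have Mle : cnorm M <= c ^+ 2.
  rewrite ME; apply: le_trans (cnormM _ _) _; rewrite cnorm_star.
  apply: le_trans (ler_wpM2r (cnorm_ge0 y) (cnormM _ _)) _.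
  rewrite mulrAC -expr2 cy [leRHS]expr2 ler_wpM2l//; first exact: sqr_ge0.
  by apply: sub_sq_le => //; rewrite cv.
pose a := (2 * cnorm r)%:C *: (r * r * r).
pose b := c%:C *: m - m * m.
have mm : m * m = r * (r * r * r) by rewrite yr !mulrA.
have MM : M * M = a * a + b * b.
  rewrite /M sqD_comm -/b; last by apply: commZl; exact: commrM.
  congr (_ + _); rewrite rscaleM -scalerAl yr scalerMnl -rmorphMn !mulrA.
  by congr (_%:C *: _); rewrite /c; lra.
have rm : GRing.comm r m by rewrite yr; exact: commrM.
have ab : GRing.comm a b.
  apply: commZl; apply: commr_sym; rewrite -mulrA.
  have br : GRing.comm b r.
    apply: commr_sym; apply: commrB; last exact: commrM.
    by apply: commr_sym; apply: commZl; exact: commr_sym.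
  by apply: commrM => //; exact: commrM.
have as' : star a = a by rewrite starZr !starM rs mulrA.
have ms : star m = m by rewrite starM starK.
have bs : star b = b by rewrite starB starZr ms starM ms.
have := cnorm_sq_le as' bs ab; rewrite -MM.
rewrite cnormZr ger0_norm ?mulr_ge0 ?cnorm_ge0//.
have := cnormM M M; have := cnormM r (r * r * r).
have -> : cnorm (r * (r * r * r)) = c ^+ 2.
  by rewrite -mm cnorm_sq// yr cnorm_sq.
have := cnorm_ge0 (r * r * r); have := cnorm_ge0 r; have := cnorm_ge0 M.
move: Mle; rewrite /c; set n := cnorm r; set w := cnorm (r * r * r).
set Mn := cnorm M; set M2 := cnorm (M * M).
move=> h1 h2 h3 h4 h5 h6 h7.
(* With [c = n^2], the estimates chain to [4 c^4 <= (2 n w)^2 <= M2 <= Mn^2 <= c^4]. *)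
have n0 : n = 0.
  apply/eqP; rewrite -2!sqrf_eq0; set p := (n ^+ 2) ^+ 2 in h1 h5 *.
  rewrite -sqrf_eq0 eq_le sqr_ge0 andbT; have p0 : 0 <= p by exact: sqr_ge0.
  have := ler_pM h2 h2 h1 h1; have := ler_pM p0 p0 h5 h5.
  by rewrite -mulrA exprMn in h7; lra.
apply: cnorm_eq0; apply/eqP; rewrite -sqrf_eq0 cy /c -/n n0 expr0n; exact: eqxx.
Qed.

Lemma star_mul_sq x : exists2 q, star q = q & star x * x = q * q.
Proof.
set h := star x * x; have hs : star h = h by rewrite starM starK.
have [p [q [[ps pE pc] [qs qE qc]]]] := abs_sqrt hs.
have ph : GRing.comm p h by apply: pc; apply: commr_sym; exact: commrM.
have pd : p = h; last by exists q => //; rewrite -pd.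
(* [d] is twice the negative part of [h]; the aim is [d = 0]. *)
pose d := p - h; have ds : star d = d by rewrite starB ps hs.
have pd : GRing.comm p d by exact: commrB.
have qd : GRing.comm q d by exact: qc.
have hd : h * d = - (p * d).
  by rewrite /d !mulrBr opprB -pE ph.
pose y := x * d; pose v := q * d.
have vs : star v = v by rewrite starM qs ds -qd.
have yv : star y * y = - (v * v).
  rewrite starM ds -mulrA [star x * _]mulrA -/h hd mulrN; congr (- _).
  by rewrite qE {1}/v qd /v !mulrA.
(* Up to sign, twice the real and imaginary parts of [y]. They give [2 y y^* = a^2 + b^2 + 2 v^2], a
   sum of squares, hence the square of [r3]. *)
pose a := y + star y; pose b := 'i *: (y - star y).
have as' : star a = a by rewrite starD starK addrC.
have bs : star b = b by rewrite starZi starB starK -scalerN opprB.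
have ab : a * a + b * b = (y * star y + star y * y) *+ 2.
  rewrite -scalerAl -scalerAr scale_ii sqD sqB opprB [LHS]addrC subrKA.
  by rewrite -mulr2n.
have [r1 [r1s r1E _]] := sqD_sqrt as' bs.
have [r2 [r2s r2E _]] := sqD_sqrt vs vs.
have [r3 [r3s r3E _]] := sqD_sqrt r1s r2s.
have y0 : y = 0.
  apply: (@neg_star_mul_pos y v ((Num.sqrt 2)^-1%:C *: r3)) => //.
    by rewrite starZr r3s.
  rewrite rscaleM -r3E -r1E -r2E ab -mulr2n -mulrnDl yv subrK.
  rewrite -scalerMnr scalerMnl -rmorphMn -invfM -expr2 sqr_sqrtr ?ler0n//.
  by rewrite -mulr_natr mulVf ?pnatr_eq0// scale1r.
have hd0 : h * d = 0 by rewrite /h -mulrA -/y y0 mulr0.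
have dd0 : star d * d = 0.
  by rewrite ds {1}/d mulrBl hd0 subr0; apply/eqP; rewrite -oppr_eq0 -hd hd0.
by apply/eqP; rewrite -subr_eq0 -/d (star_mul_eq0 dd0).
Qed.

Lemma sum_star_mul_eq0 (I : finType) (F : I -> B) :
  \sum_i star (F i) * F i = 0 -> forall i, F i = 0.
Proof.
move=> F0 i.
have [q qs qE] : exists2 q, star q = q &
    \sum_(j | j != i) star (F j) * F j = q * q.
  apply: (big_ind (fun z : B => exists2 q, star q = q & z = q * q)) =>
    [|_ _ [s ss ->] [v vs ->]|j _].
  - by exists 0; rewrite ?star0 ?mulr0.
  - by have [q [? ? _]] := sqD_sqrt ss vs; exists q.
  - exact: star_mul_sq.
have [s ss sE] := star_mul_sq (F i).
apply: star_mul_eq0; move: F0; rewrite (bigD1 i)//= qE sE => sq0.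
by rewrite (sqD_eq0 ss qs sq0) mulr0.
Qed.

End CStarAlgebraTheory.

(** * Subalgebras and their relative commutants *)

Section Subalgebra.
Variables (R : realType) (B : cstarAlgebraType R) (A : set B).
Hypothesis hA : cstar_subalgebra A.
Implicit Types (x y a b c : B) (E F : B -> B).

Lemma csubB x y : A x -> A y -> A (x - y).
Proof.
by move=> Ax Ay; rewrite -scaleN1r; apply: csubD => //; exact: csubZ.
Qed.

Lemma relative_commutantB x y : relative_commutant A x ->
  relative_commutant A y -> relative_commutant A (x - y).
Proof. by move=> Cx Cy a Aa; rewrite mulrBr mulrBl Cx ?Cy. Qed.

Lemma relative_commutantZ (t : R[i]) x : relative_commutant A x ->
  relative_commutant A (t *: x).
Proof. by move=> Cx a Aa; rewrite -scalerAr -scalerAl Cx. Qed.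

Lemma relative_commutant_star x : relative_commutant A x ->
  relative_commutant A (star x).
Proof.
move=> Cx a Aa; apply: (can_inj (@starK R B)); rewrite !starM starK.
by rewrite Cx//; exact: csub_star.
Qed.

(** * Bimodularity and faithfulness of conditional expectations *)

Section ConditionalExpectation.
Variables (E : B -> B).
Hypothesis hE : conditional_expectation A E.

Lemma cexpD x y : E (x + y) = E x + E y.
Proof. by have := cexp_linear hE 1 x y; rewrite !scale1r. Qed.

Lemma cexp0 : E 0 = 0.
Proof. by apply: (addrI (E 0)); rewrite -cexpD !addr0. Qed.

Lemma cexpB x y : E (x - y) = E x - E y.
Proof.
rewrite cexpD; congr (_ + _).
by apply: (addrI (E y)); rewrite -cexpD !subrr cexp0.
Qed.

Lemma cexpZ (t : R[i]) x : E (t *: x) = t *: E x.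
Proof. by have := cexp_linear hE t x 0; rewrite cexp0 !addr0. Qed.

Lemma cexp_sum (I : Type) (r : seq I) (P : pred I) (f : I -> B) :
  E (\sum_(i <- r | P i) f i) = \sum_(i <- r | P i) E (f i).
Proof. exact: (big_morph _ cexpD cexp0). Qed.

(** The matrix of the [star (b i) * b j] is [Y^* Y], where [Y] has first row [b] and zeros
    elsewhere. *)
Lemma cexp_gram n (b : 'I_n.+1 -> B) : exists W : 'M[B]_n.+1,
  forall i j, E (star (b i) * b j) = \sum_k star (W k i) * W k j.
Proof.
pose Y : 'M[B]_n.+1 := \matrix_(k, j) if k == ord0 then b j else 0.
have [W _ WE] : mx_positive A (map_mx E (mx_star Y *m Y)).
  by apply: (cexp_cp hE); exists Y.
exists W => i j; move/matrixP/(_ i j): WE; rewrite !mxE.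
under [X in E X]eq_bigr do rewrite !mxE.
rewrite (bigD1 ord0)//= big1 => [|k /negPf ->]; last by rewrite mulr0.
by rewrite addr0 => ->; apply: eq_bigr => k _; rewrite !mxE.
Qed.

Lemma cexp_star x : E (star x) = star (E x).
Proof.
have [W WE] := cexp_gram (fun i : 'I_2 => if i == ord0 then 1 else x).
have := WE ord0 ord_max; have := WE ord_max ord0.
rewrite /= star1 mul1r mulr1 => -> ->; rewrite star_sum; apply: eq_bigr => k _.
by rewrite starM starK.
Qed.

(* In the Gram matrix of the columns [E] attaches to (1, a, b), the column of
   [a] is that of [1] times [a], since [E (a^* a) = E (a)^* E (a)]. *)
Lemma cexp_bimodule a b : A a -> E (b * a) = E b * a.
Proof.
move=> Aa; pose f (i : 'I_3) := nth 0 [:: 1; a; star b] i.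
have [W WE] := cexp_gram f.
pose i0 : 'I_3 := ord0; pose i1 : 'I_3 := lift ord0 ord0.
pose i2 : 'I_3 := ord_max.
have W1 k : W k i1 = W k i0 * a.
  apply/eqP; rewrite -subr_eq0; apply/eqP; move: k; apply: sum_star_mul_eq0.
  under eq_bigr do rewrite starB starM mulrBr !mulrBl.
  rewrite !sumrB.
  under [X in _ - X - _]eq_bigr do rewrite -mulrA.
  under [X in _ - (X - _)]eq_bigr do rewrite mulrA.
  under [X in _ - (_ - X)]eq_bigr do rewrite mulrA -[_ * W _ i0]mulrA.
  rewrite -!mulr_suml -!mulr_sumr -!WE /f /= star1 !mul1r mulr1.
  have As := csub_star hA Aa.
  rewrite (cexp1 hE) mulr1 (cexp_id hE Aa) (cexp_id hE As).
  by rewrite (cexp_id hE (csubM hA As Aa)) !subrr.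
have := WE i2 i1; have := WE i2 i0.
rewrite /f /= starK mulr1 => -> ->; rewrite mulr_suml.
by apply: eq_bigr => k _; rewrite W1 mulrA.
Qed.

Lemma cexp_bimodule_l a b : A a -> E (a * b) = a * E b.
Proof.
move=> Aa; apply: (can_inj (@starK R B)).
by rewrite -cexp_star !starM cexp_bimodule ?cexp_star//; exact: csub_star.
Qed.

(** A degenerate Cauchy-Schwarz inequality: the hypothesis kills the column of [x] in the Gram
    factor of [x] and [star y]. *)
Lemma cexp_null x y : E (star x * x) = 0 -> E (y * x) = 0.
Proof.
have [W WE] := cexp_gram (fun i : 'I_2 => if i == ord0 then x else star y).
have /= := WE ord0 ord0; have := WE ord_max ord0.
rewrite /= starK => -> -> /sum_star_mul_eq0 W0.
by apply: big1 => k _; rewrite W0 mulr0.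
Qed.

Lemma finite_index_faithful x :
  finite_index E -> E (star x * x) = 0 -> x = 0.
Proof.
move=> [n [u [v uv]]] x0; have [-> _] := uv x.
by apply: big1 => j _; rewrite cexp_null ?mulr0.
Qed.

End ConditionalExpectation.

(** * The two directions of the equivalence *)

Lemma cexp_unique E F : conditional_expectation A E -> finite_index E ->
  conditional_expectation A F ->
  (forall b, relative_commutant A b -> A b) -> forall b, F b = E b.
Proof.
move=> hE [n [u [v uv]]] hF CA; pose h := \sum_j F (u j) * v j.
(* [h] acts as a density of [F] with respect to [E]: apply [F] to the first quasi-basis expansion of
   [b] and use bimodularity of both maps. *)
have FE b : F b = E (h * b).
  have [bE _] := uv b.
  rewrite [in LHS]bE (cexp_sum hF) /h mulr_suml (cexp_sum hE).
  apply: eq_bigr => j _; rewrite (cexp_bimodule hF)//; last first.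
    exact: cexp_range hE _.
  by rewrite -mulrA [RHS](cexp_bimodule_l hE)//; exact: cexp_range hF _.
have E0 x : (forall b, E (x * b) = 0) -> x = 0.
  by move=> x0; have [_ ->] := uv x; apply: big1 => j _; rewrite x0 mul0r.
(* [E ((a h - h a) b) = a F b - F (a b) = 0] for all [b]. *)
have Ah : A h.
  apply: CA => a Aa; apply/eqP; rewrite -subr_eq0; apply/eqP; apply: E0 => b.
  rewrite mulrBl -!mulrA (cexpB hE) (cexp_bimodule_l hE)// -!FE.
  by rewrite (cexp_bimodule_l hF)// subrr.
have h1 : h = 1 by rewrite -(cexp_id hE Ah) -(mulr1 h) -FE (cexp1 hF).
by move=> b; rewrite FE h1 mul1r.
Qed.

(** Since [g] commutes with [A], [E (g a g) = a E (g^2) = a]. Complete positivity survives because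
    conjugating [Y^* Y] entrywise by [g] replaces [Y] by [Y g]. *)
Lemma conditional_expectation_conj E g : conditional_expectation A E ->
  star g = g -> relative_commutant A g -> E (g * g) = 1 ->
  conditional_expectation A (fun b => E (g * b * g)).
Proof.
move=> hE gs Cg gg; split=> [b|t x y||n X [Y _ XE]|a Aa].
- exact: cexp_range hE _.
- by rewrite mulrDr mulrDl -scalerAr -scalerAl (cexp_linear hE).
- by rewrite mulr1.
- have -> : map_mx (fun b => E (g * b * g)) X =
      map_mx E (map_mx (fun b => g * b * g) X).
    by apply/matrixP => i j; rewrite !mxE.
  apply: (cexp_cp hE); exists (map_mx (fun b => b * g) Y) => //.
  apply/matrixP => i j; rewrite !mxE XE !mxE mulr_sumr mulr_suml.
  by apply: eq_bigr => k _; rewrite !mxE starM gs !mulrA.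
- by rewrite -Cg// -mulrA cexp_bimodule_l// gg mulr1.
Qed.

Lemma relative_commutant_sub E c : conditional_expectation A E ->
  finite_index E -> (forall F, conditional_expectation A F -> F = E) ->
  relative_commutant A c -> A c.
Proof.
move=> hE fE uE.
have sa x : star x = x -> relative_commutant A x -> A x.
  move=> xs Cx; pose d := x - E x.
  suff d0 : d = 0.
    by move/eqP: d0; rewrite subr_eq0 => /eqP ->; exact: cexp_range hE _.
  have ds : star d = d by rewrite starB -(cexp_star hE) xs.
  have Ed : E d = 0.
    by rewrite (cexpB hE) (cexp_id hE (cexp_range hE x)) subrr.
  have Cd : relative_commutant A d.
    apply: relative_commutantB => // a Aa.
    by rewrite -(cexp_bimodule_l hE)// -(cexp_bimodule hE)// Cx.
  have [/cnorm_eq0 //|dn0] := eqVneq (cnorm d) 0.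
  pose k := (- (cnorm d)^-1)%:C *: d.
  have Ek : E k = 0 by rewrite (cexpZ hE) Ed scaler0.
  have ks : star k = k by rewrite starZr ds.
  have k1 : cnorm k <= 1.
    by rewrite cnormZr normrN ger0_norm ?invr_ge0 ?cnorm_ge0// mulVf.
  have [g [gs gE _ gc]] := sqrt_one_sub ks k1.
  have Cg : relative_commutant A g.
    move=> a Aa; apply: commr_sym; apply: gc; apply: commr_sym.
    exact: relative_commutantZ Cd a Aa.
  have gg : E (g * g) = 1 by rewrite -gE (cexpB hE) Ek subr0 (cexp1 hE).
  have /uE/(congr1 (@^~ k)) /= gkg := conditional_expectation_conj hE gs Cg gg.
  have k0 : k = 0.
    apply: (finite_index_faithful hE fE); rewrite ks.
    (* [g] commutes with [k] and [g^2 = 1 - k], so [g k g = k - k^2]. *)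
    have -> : k * k = k - g * k * g.
      by rewrite -mulrA -(gc k (erefl _)) mulrA -gE mulrBl mul1r subKr.
    by rewrite (cexpB hE) gkg subrr.
  apply/eqP; move/eqP: k0; rewrite scaler_eq0 => /orP[|//].
  by rewrite fmorph_eq0 oppr_eq0 invr_eq0 (negPf dn0).
(* A general [c] is a combination of two self-adjoint elements of the relative commutant. *)
move=> Cc; have Cs := relative_commutant_star Cc.
have A1 : A (c + star c).
  apply: sa; first by rewrite starD starK addrC.
  rewrite -[star c]opprK; apply: relative_commutantB => //.
  by rewrite -scaleN1r; exact: relative_commutantZ.
have A2 : A ('i *: (c - star c)).
  apply: sa; first by rewrite starZi starB starK -scalerN opprB.
  by apply: relative_commutantZ; exact: relative_commutantB.
have -> : c = 2^-1%:C *: ((c + star c) - 'i *: ('i *: (c - star c))).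
  by rewrite scale_ii opprK addrACA subrr addr0 scalerDr scale_half_add.
by apply: csubZ => //; apply: csubB => //; exact: csubZ.
Qed.

End Subalgebra.

Theorem theorem2p7 (R : realType) (B : cstarAlgebraType R) (A : set B)
    (hA : cstar_subalgebra A) (hfin : finite_index_inclusion A) :
  (exists! E : B -> B, conditional_expectation A E) <->
  relative_commutant A = alg_center A.
Proof.
have [E hE fE] := hfin; split=> [[E0 [_ uE0]]|CZ].
  have uE F : conditional_expectation A F -> F = E.
    by move=> hF; rewrite -(uE0 F hF) (uE0 E hE).
  apply/seteqP; split=> c; last by case.
  by move=> Cc; split=> //; exact: relative_commutant_sub hE fE uE Cc.
exists E; split=> // F hF; apply/funext => b; apply/esym.
apply: (cexp_unique hA hE fE hF) => c.
by rewrite CZ => -[].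
Qed.
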